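(* Let $p$ be a prime and let $f\colon \mathbb{Z}_p\to\mathbb{Z}_p$ be a compatible function with coordinate representation $$f(x_0+px_1+\ldots+p^kx_k+\ldots)=\varphi_0(x_0)+p\varphi_1(x_0,x_1)+\ldots+p^k\varphi_k(x_0,x_1,\ldots,x_k)+\ldots .$$ Then $f$ preserves the normalized Haar measure $\mu_p$ if and only if both of the following hold: (1) $\varphi_0$ is bijective on the set $\{0,1,\ldots,p-1\}$ of residues modulo $p$; (2) for every $k=1,2,\ldots$ and every fixed $(x_0,\ldots,x_{k-1})\in\{0,\ldots,p-1\}^k$, the map $x_k\mapsto \varphi_k(x_0,\ldots,x_{k-1},x_k)$ is bijective on the set $\{0,1,\ldots,p-1\}$ of residues modulo $p$.
   Context: $\mathbb{Z}_p$ is the ring of $p$-adic integers, $|\cdot|_p$ the $p$-adic valuation, $\mu_p$ the Haar measure on $\mathbb{Z}_p$ normalized by $\mu_p(\mathbb{Z}_p)=1$. A function $f\colon\mathbb{Z}_p\to\mathbb{Z}_p$ is compatible if $|f(x)-f(y)|_p\le|x-y|_p$ for all $x,y\in\mathbb{Z}_p$ (equivalently, $x\equiv y \bmod p^k$ implies $f(x)\equiv f(y)\bmod p^k$ for all $k\ge 1$). Every $x\in\mathbb{Z}_p$ has a canonical expansion $x=x_0+px_1+p^2x_2+\ldots$ with $x_i\in\{0,\ldots,p-1\}$. For a compatible $f$ the $k$-th base-$p$ digit of $f(x)$ depends only on $x_0,\ldots,x_k$; it is denoted $\varphi_k(x_0,\ldots,x_k)\in\{0,\ldots,p-1\}$,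 which gives the (unique) coordinate representation of $f$. The set $\{0,\ldots,p-1\}$ is identified with $\mathbb{Z}/p\mathbb{Z}$. $f$ preserves measure if $\mu_p(f^{-1}(S))=\mu_p(S)$ for every measurable $S\subset\mathbb{Z}_p$. *)

(* Defs.v *)
From HB Require Import structures.
From mathcomp Require Import all_boot all_order all_algebra.
From mathcomp Require Import all_classical all_reals all_analysis.
Set Implicit Arguments.
Unset Strict Implicit.
Unset Printing Implicit Defensive.
Import Order.TTheory GRing.Theory Num.Theory.
Local Open Scope classical_set_scope.
Local Open Scope ring_scope.

(* Z_p as the inverse limit of the Z/p^k: [padic_res x k] is the representative
   of x mod p^k in {0, .., p^k - 1}; the single equation below gives both the
   bound and the coherence.  The (phantom) primality proof is a parameter so
   that the ring structure can be canonical. *)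
Record padic_int (p : nat) (p_pr : prime p) := PadicInt {
  padic_res : nat -> nat;
  padic_resP : forall k, padic_res k = (padic_res k.+1 %% p ^ k)%N }.

Section PadicRing.
Variables (p : nat) (p_pr : prime p).
Local Notation Zp := (padic_int p_pr).
Implicit Types (x y z : Zp) (k : nat).

Lemma padic_eqP x y : (forall k, padic_res x k = padic_res y k) -> x = y.
Proof.
case: x y => [u hu] [v hv] /= /funext uv; subst v.
by rewrite (Prop_irrelevance hu hv).
Qed.

Lemma padic_pow_gt0 k : (0 < p ^ k)%N.
Proof. by rewrite expn_gt0 prime_gt0. Qed.

Lemma padic_res_lt x k : (padic_res x k < p ^ k)%N.
Proof. by rewrite padic_resP ltn_mod padic_pow_gt0. Qed.

Lemma padic_res_small x k : (padic_res x k %% p ^ k)%N = padic_res x k.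
Proof. by rewrite modn_small// padic_res_lt. Qed.

Lemma padic_res_mod x k : padic_res x k.+1 = padic_res x k %[mod p ^ k].
Proof. by rewrite -padic_resP padic_res_small. Qed.

Lemma padic_mk_subproof (g : nat -> nat) :
  (forall k, g k.+1 = g k %[mod p ^ k]) ->
  forall k, (g k %% p ^ k = (g k.+1 %% p ^ k.+1) %% p ^ k)%N.
Proof.
by move=> hg k; rewrite -hg modn_dvdm// expnS dvdn_mull.
Qed.

Definition padic_mk (g : nat -> nat)
    (hg : forall k, g k.+1 = g k %[mod p ^ k]) : Zp :=
  PadicInt p_pr (padic_mk_subproof hg).

Lemma padic_nat_subproof (n : nat) k : n = n %[mod p ^ k].
Proof. by []. Qed.

Lemma padic_add_subproof x y k :
  padic_res x k.+1 + padic_res y k.+1 =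
  padic_res x k + padic_res y k %[mod p ^ k].
Proof. by rewrite -modnDm !padic_res_mod modnDm. Qed.

Lemma padic_mul_subproof x y k :
  padic_res x k.+1 * padic_res y k.+1 =
  padic_res x k * padic_res y k %[mod p ^ k].
Proof. by rewrite -modnMm !padic_res_mod modnMm. Qed.

Lemma padic_opp_subproof x k :
  (p ^ k.+1 - padic_res x k.+1 = p ^ k - padic_res x k %[mod p ^ k])%N.
Proof.
apply/eqP; rewrite -(eqn_modDr (padic_res x k.+1)) subnK; last first.
  exact/ltnW/padic_res_lt.
rewrite eq_sym -modnDmr padic_res_mod modnDmr subnK; last first.
  exact/ltnW/padic_res_lt.
by rewrite modnn expnS modnMl.
Qed.

Definition padic_nat n : Zp := padic_mk (padic_nat_subproof n).
Definition padic_add x y : Zp := padic_mk (padic_add_subproof x y).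
Definition padic_mul x y : Zp := padic_mk (padic_mul_subproof x y).
Definition padic_opp x : Zp := padic_mk (padic_opp_subproof x).

Let addA : associative padic_add.
Proof. by move=> x y z; apply: padic_eqP => k /=; rewrite modnDml modnDmr addnA. Qed.
Let addC : commutative padic_add.
Proof. by move=> x y; apply: padic_eqP => k /=; rewrite addnC. Qed.
Let add0 : left_id (padic_nat 0) padic_add.
Proof. by move=> x; apply: padic_eqP => k /=; rewrite mod0n add0n padic_res_small. Qed.
Let addN : left_inverse (padic_nat 0) padic_opp padic_add.
Proof.
move=> x; apply: padic_eqP => k /=.
by rewrite modnDml subnK ?modnn ?mod0n//; exact/ltnW/padic_res_lt.
Qed.
Let mulA : associative padic_mul.
Proof. by move=> x y z; apply: padic_eqP => k /=; rewrite modnMml modnMmr mulnA. Qed.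
Let mulC : commutative padic_mul.
Proof. by move=> x y; apply: padic_eqP => k /=; rewrite mulnC. Qed.
Let mul1 : left_id (padic_nat 1) padic_mul.
Proof. by move=> x; apply: padic_eqP => k /=; rewrite modnMml mul1n padic_res_small. Qed.
Let mulD : left_distributive padic_mul padic_add.
Proof.
by move=> x y z; apply: padic_eqP => k /=; rewrite modnMml modnDm mulnDl.
Qed.
Let one_neq0 : padic_nat 1 != padic_nat 0 :> {classic Zp}.
Proof.
apply/eqP => /(congr1 (fun x : Zp => padic_res x 1)) /=.
by rewrite expn1 mod0n modn_small// prime_gt1.
Qed.

HB.instance Definition _ := gen_eqMixin Zp.
HB.instance Definition _ := gen_choiceMixin Zp.
HB.instance Definition _ := GRing.isZmodule.Build Zp addA addC add0 addN.
HB.instance Definition _ := GRing.Zmodule_isComNzRing.Build Zp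
  mulA mulC mul1 mulD one_neq0.
HB.instance Definition _ := isPointed.Build Zp 0.

Lemma padic_digit_subproof x i : (padic_res x i.+1 %/ p ^ i < p)%N.
Proof. by rewrite ltn_divLR ?padic_pow_gt0// -expnS padic_res_lt. Qed.

Definition padic_digit x i : 'I_p := Ordinal (padic_digit_subproof x i).

Lemma padic_res_digits x k :
  padic_res x k = (\sum_(i < k) padic_digit x i * p ^ i)%N.
Proof.
elim: k => [|k IH]; last first.
  by rewrite big_ord_recr/= -IH [in RHS]addnC (padic_resP x k) -divn_eq.
by rewrite big_ord0; have := padic_res_lt x 0; rewrite expn0 ltnS leqn0 => /eqP.
Qed.

Lemma padic_res_natr n k : padic_res (n%:R : Zp) k = (n %% p ^ k)%N.
Proof.
elim: n => [|n IH] //.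
by rewrite -natr1 [LHS]/= IH modnDm addn1.
Qed.

Lemma padic_res_sub0 x y k :
  (padic_res (x - y) k == 0%N) = (padic_res x k == padic_res y k).
Proof.
rewrite [padic_res _ _]/= modnDmr -(mod0n (p ^ k)) -(eqn_modDr (padic_res y k)).
rewrite -addnA subnK; last exact/ltnW/padic_res_lt.
by rewrite modnDr add0n !padic_res_small.
Qed.

Lemma padic_res0_le x k l :
  (l <= k)%N -> padic_res x k = 0%N -> padic_res x l = 0%N.
Proof.
move=> /subnK <-; elim: (k - l)%N => [//|n IH] h; apply: IH.
by rewrite padic_resP -addSn h mod0n.
Qed.

(* |x|_p = p^-v with v the largest k such that p^k divides x, and |0|_p = 0. *)
Definition padic_abs x : rat :=
  if pselect (exists k, padic_res x k.+1 != 0%N) is left ex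
  then p%:R ^- ex_minn ex else 0.

Lemma padic_abs_ge0 x : 0 <= padic_abs x.
Proof. by rewrite /padic_abs; case: pselect => // ?; rewrite invr_ge0 exprn_ge0. Qed.

Lemma padic_abs_le x k : (padic_abs x <= p%:R ^- k) = (padic_res x k == 0%N).
Proof.
have p1 : (1 < p%:R :> rat) by rewrite ltr1n prime_gt1.
have p0 : (0 < p%:R :> rat) by rewrite (lt_trans _ p1).
rewrite /padic_abs; case: pselect => [ex|nex].
  case: ex_minnP => m hm mmin.
  rewrite lef_pV2 ?posrE ?exprn_gt0// ler_eXn2l//.
  apply/idP/eqP => [km|hk].
    case: k km => [|k] km.
      by have := padic_res_lt x 0; rewrite expn0 ltnS leqn0 => /eqP.
    by apply/eqP; apply: contraTT km => /mmin; rewrite -leqNgt.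
  rewrite leqNgt; apply/negP => mk.
  by move: hm; rewrite (padic_res0_le mk hk).
rewrite invr_ge0 exprn_ge0 ?ltW//; apply/esym/eqP.
case: k => [|k]; first by have := padic_res_lt x 0; rewrite expn0 ltnS leqn0 => /eqP.
by apply/eqP; rewrite -[_ == _]negbK; apply/negP => h; apply: nex; exists k.
Qed.

Lemma padic_abs_cases x : padic_abs x = 0 \/ exists k, padic_abs x = p%:R ^- k.
Proof. by rewrite /padic_abs; case: pselect => [ex|_]; [right; eexists|left]. Qed.

Lemma padic_abs0P x : padic_abs x = 0 <-> x = 0.
Proof.
split=> [x0|->].
  apply: padic_eqP => k; rewrite [RHS](mod0n (p ^ k)).
  by apply/eqP; rewrite -padic_abs_le x0 invr_ge0 exprn_ge0.
rewrite /padic_abs; case: pselect => // ex; exfalso; case: ex => k.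
by rewrite [padic_res _ _](mod0n (p ^ k.+1)).
Qed.

Lemma padic_dist_le x y k :
  (padic_abs (x - y) <= p%:R ^- k) = (padic_res x k == padic_res y k).
Proof. by rewrite padic_abs_le padic_res_sub0. Qed.

Lemma padic_absN x : padic_abs (- x) = padic_abs x.
Proof.
have h z : padic_abs z <= padic_abs (- z).
  case: (padic_abs_cases (- z)) => [/padic_abs0P/eqP|[k nz]].
    by rewrite oppr_eq0 => /eqP ->; rewrite oppr0.
  have : padic_abs (0 - z) <= p%:R ^- k by rewrite sub0r nz.
  by rewrite nz padic_dist_le eq_sym -padic_dist_le subr0.
by apply/eqP; rewrite eq_le h andbT -{2}[x]opprK h.
Qed.

Lemma padic_abs_ultra x y :
  padic_abs (x + y) <= Num.max (padic_abs x) (padic_abs y).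
Proof.
set m := Num.max _ _.
have hm : m = 0 \/ exists k, m = p%:R ^- k.
  by rewrite /m; case: leP => _; exact: padic_abs_cases.
have [xm ym] : padic_abs x <= m /\ padic_abs y <= m by rewrite !le_max !lexx orbT.
case: hm => [m0|[k mk]].
  have h z : padic_abs z <= m -> z = 0.
    by rewrite m0 => z0; apply/padic_abs0P/eqP; rewrite eq_le z0 padic_abs_ge0.
  by rewrite (h x)// (h y)// addr0 (padic_abs0P 0).2// m0.
move: xm ym; rewrite mk !padic_abs_le => /eqP x0 /eqP y0.
by rewrite [padic_res _ _]/= x0 y0 mod0n.
Qed.

Let dist x y : rat := padic_abs (x - y).
Let distxx x : dist x x = 0.
Proof. by apply/padic_abs0P; rewrite subrr. Qed.
Let dist_pos x y : dist x y = 0 -> x = y.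
Proof. by move/padic_abs0P/eqP; rewrite subr_eq0 => /eqP. Qed.
Let dist_sym x y : dist x y = dist y x.
Proof. by rewrite /dist -opprB padic_absN. Qed.
Let dist_tri y x z : dist x z <= dist x y + dist y z.
Proof.
rewrite /dist -[x - z](subrKA y) (le_trans (padic_abs_ultra _ _))// ge_max.
by rewrite lerDl lerDr !padic_abs_ge0.
Qed.

HB.instance Definition _ := isMetric.Build rat Zp
  distxx dist_pos dist_sym dist_tri.

Lemma padic_mdistE x y : mdist x y = padic_abs (x - y).
Proof. by []. Qed.

Lemma padic_ballP x y k :
  ball x (p%:R ^- k : rat) y <-> padic_res x k.+1 = padic_res y k.+1.
Proof.
have p1 : (1 < p%:R :> rat) by rewrite ltr1n prime_gt1.
have p0 : (0 < p%:R :> rat) by rewrite (lt_trans _ p1).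
rewrite ballEmdist /= padic_mdistE.
have -> : (padic_abs (x - y) < p%:R ^- k) = (padic_abs (x - y) <= p%:R ^- k.+1).
  case: (padic_abs_cases (x - y)) => [->|[l ->]].
    by rewrite !invr_gt0 invr_ge0 exprn_gt0// ltW// exprn_gt0.
  by rewrite ltf_pV2 ?lef_pV2 ?posrE ?exprn_gt0// ltr_eXn2l// ler_eXn2l.
by rewrite padic_dist_le; split=> /eqP.
Qed.

(* x_0 + p x_1 + p^2 x_2 + ..., as the limit of the partial sums for |.|_p *)
Definition padic_series (a : nat -> 'I_p) : Zp :=
  limn (series (fun i => (a i)%:R * p%:R ^+ i : Zp)).

Lemma padic_psum_lt (a : nat -> 'I_p) k :
  (\sum_(i < k) a i * p ^ i < p ^ k)%N.
Proof.
elim: k => [|k IH]; first by rewrite big_ord0 expn0.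
rewrite big_ord_recr/= (leq_trans (n := p ^ k + a k * p ^ k))//.
  by rewrite ltn_add2r.
by rewrite -mulSn expnS leq_mul2r ltn_ord orbT.
Qed.

Lemma padic_res_psum (a : nat -> 'I_p) n k : (k <= n)%N ->
  padic_res (series (fun i => (a i)%:R * p%:R ^+ i : Zp) n) k =
  (\sum_(i < k) a i * p ^ i)%N.
Proof.
move=> kn.
have -> : series (fun i => (a i)%:R * p%:R ^+ i : Zp) n =
    (\sum_(i < n) a i * p ^ i)%N%:R.
  by rewrite seriesEord/= natr_sum; apply: eq_bigr => i _; rewrite natrM natrX.
rewrite padic_res_natr -(subnKC kn) big_split_ord/=.
under [X in (_ + X)%N]eq_bigr do rewrite expnD mulnCA.
by rewrite -big_distrr/= addnC mulnC modnMDl modn_small// padic_psum_lt.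
Qed.

Lemma cvg_padic_series x (u : nat -> Zp) :
  (forall k n, (k <= n)%N -> padic_res (u n) k = padic_res x k) ->
  u @ \oo --> x.
Proof.
have p1 : (1 < p%:R :> rat) by rewrite ltr1n prime_gt1.
have p0 : (0 < p%:R :> rat) by rewrite (lt_trans _ p1).
move=> h; apply/cvg_ballP => e e0.
have [k ke] : exists k, p%:R ^- k <= e.
  exists (Num.bound e^-1); rewrite invf_ple ?posrE ?exprn_gt0//.
  rewrite (le_trans (ltW (archi_boundP _)))// ?invr_ge0 ?ltW//.
  by rewrite -natrX ltr_nat ltn_expl// prime_gt1.
exists k.+1 => // n /= kn; apply: (le_ball ke).
by apply/padic_ballP; rewrite h.
Qed.

Lemma padic_digitK x : padic_series (padic_digit x) = x.
Proof.
apply: cvg_lim; first exact: metric_hausdorff.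
by apply: cvg_padic_series => k n kn; rewrite padic_res_psum// -padic_res_digits.
Qed.

Lemma padic_seriesK (a : nat -> 'I_p) : padic_digit (padic_series a) = a.
Proof.
have hg k : (\sum_(i < k.+1) a i * p ^ i = \sum_(i < k) a i * p ^ i %[mod p ^ k])%N.
  by rewrite big_ord_recr/= addnC modnMDl.
have -> : padic_series a = padic_mk hg.
  apply: cvg_lim; first exact: metric_hausdorff.
  apply: cvg_padic_series => k n kn.
  by rewrite padic_res_psum//= modn_small// padic_psum_lt.
apply/funext => k; apply: val_inj => /=.
rewrite modn_small ?padic_psum_lt// big_ord_recr/= addnC.
by rewrite divnMDl ?padic_pow_gt0// divn_small ?addn0// padic_psum_lt.
Qed.

HB.instance Definition _ := Measurable.copy Zp (g_sigma_algebraType (@open Zp)).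

Lemma padic_measurableE : @measurable _ Zp = <<s @open Zp >>.
Proof. by []. Qed.

Definition compatible (f : Zp -> Zp) :=
  forall x y, padic_abs (f x - f y) <= padic_abs (x - y).

Lemma compatibleP (f : Zp -> Zp) : compatible f <->
  forall k x y, padic_res x k = padic_res y k ->
    padic_res (f x) k = padic_res (f y) k.
Proof.
split=> [hf k x y /eqP|hf x y].
  rewrite -padic_dist_le => xy; apply/eqP; rewrite -padic_dist_le.
  exact: le_trans (hf x y) xy.
case: (padic_abs_cases (x - y)) => [/padic_abs0P/eqP|[k xyk]].
  by rewrite subr_eq0 => /eqP ->; rewrite !subrr.
by rewrite xyk padic_dist_le; apply/eqP/hf/eqP; rewrite -padic_dist_le xyk.
Qed.

Definition coordinate_representation (f : Zp -> Zp)
    (phi : forall k, k.+1.-tuple 'I_p -> 'I_p) :=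
  forall a : nat -> 'I_p,
    f (padic_series a) =
    padic_series (fun k => phi k [tuple a i | i < k.+1]).

(* The normalization mu Zp = 1 is part of the type [probability]. *)
Definition normalized_haar (R : realType) (mu : probability Zp R) :=
  forall (a : Zp) (S : set Zp), measurable S -> mu (+%R a @` S) = mu S.

Definition preserves_measure (R : realType) (mu : probability Zp R)
    (f : Zp -> Zp) :=
  forall S : set Zp, measurable S -> mu (f @^-1` S) = mu S.

End PadicRing.

(* Main.v *)
Require Import Defs.
From mathcomp Require Import all_boot all_order all_algebra.
From mathcomp Require Import all_classical all_reals all_analysis.
Import Order.TTheory GRing.Theory Num.Theory.
Local Open Scope ring_scope.

(** By Haar invariance all the residue classes mod p^k have the same measure,
    which is positive and finite, and these classes form a pi-system generating
    the Borel sets.  The preimage under a compatible f of a class mod p^k is a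
    union of classes mod p^k, hence f preserves the measure iff it induces an
    injection, equivalently a permutation, of Z/p^k for every k.  Reading
    residues digit by digit, the latter says that each map x_k |-> phi_k(...,
    x_k) is injective on the finite set {0, .., p - 1}. *)

(** Splits off the last digit, linking the tuples of [coordinate_representation] to a fixed prefix
    followed by a varying digit. *)
Lemma mktuple_rcons {T : Type} (a : nat -> T) k :
  [tuple a i | i < k.+1] = [tuple of rcons [tuple a i | i < k] (a k)].
Proof.
apply: val_inj => /=.
rewrite (map_comp a) (map_comp a (nat_of_ord (n := k))) !val_enum_ord.
by rewrite -map_rcons -cats1 -addn1 iotaD.
Qed.

(** * Residue classes as a generating pi-system *)

Section ResidueClasses.
Local Open Scope classical_set_scope.
Context {p : nat} {p_pr : prime p}.
Local Notation Zp := (padic_int p_pr).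
Implicit Types (x y : Zp) (k l r : nat) (f : Zp -> Zp).

Lemma padic_res_eq_le {x y k l} : (l <= k)%N ->
  padic_res x k = padic_res y k -> padic_res x l = padic_res y l.
Proof.
move=> lk /eqP; rewrite -padic_res_sub0 => /eqP xy.
by apply/eqP; rewrite -padic_res_sub0; apply/eqP/(padic_res0_le lk xy).
Qed.

Lemma padic_res_modX {k l} x : (l <= k)%N ->
  padic_res x l = (padic_res x k %% p ^ l)%N.
Proof.
(* x and the natural number [padic_res x k], seen in Z_p, agree mod p^k, hence mod p^l. *)
move=> lk; rewrite -(padic_res_natr p_pr); apply: (padic_res_eq_le lk).
by rewrite padic_res_natr padic_res_small.
Qed.

Lemma padic_resS x k :
  padic_res x k.+1 = (padic_res x k + padic_digit x k * p ^ k)%N.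
Proof. by rewrite !padic_res_digits big_ord_recr. Qed.

Lemma padic_res_eqP x y k : padic_res x k = padic_res y k <->
  forall i, (i < k)%N -> padic_digit x i = padic_digit y i.
Proof.
split=> [xy i ik|xy]; last first.
  by rewrite !padic_res_digits; apply: eq_bigr => i _; rewrite xy.
by apply: val_inj => /=; rewrite (padic_res_eq_le ik xy).
Qed.

(* Empty when r >= p ^ k, so that disjoint classes also meet in a class. *)
Definition residue_class k r : set Zp := [set x | padic_res x k = r].

Lemma open_residue_class k r : open (residue_class k r).
Proof.
rewrite openE => x /= xr; apply/nbhs_ballP; exists (p%:R ^- k : rat) => /=.
  by rewrite invr_gt0 exprn_gt0// ltr0n prime_gt0.
move=> y /padic_ballP xy.
by rewrite /residue_class/= -xr (padic_resP x) xy -padic_resP.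
Qed.

Lemma measurable_residue_class k r : measurable (residue_class k r).
Proof. by apply: sub_sigma_algebra; exact: open_residue_class. Qed.

Lemma residue_class_add x k :
  residue_class k (padic_res x k) = +%R x @` residue_class k 0.
Proof.
apply/seteqP; split=> [y /= yx|_ [z /= z0 <-]].
  exists (y - x); last by rewrite addrC subrK.
  by apply/eqP; rewrite padic_res_sub0 yx.
by apply/eqP; rewrite -padic_res_sub0 addrAC subrr add0r; apply/eqP.
Qed.

Definition residue_classes : set (set Zp) :=
  [set A | exists k r, A = residue_class k r].

(** For l <= k a class mod p^k lies inside a class mod p^l or is disjoint from it. *)
Lemma setI_closed_residue_classes : setI_closed residue_classes.
Proof.
suff H k r l s : (l <= k)%N ->
    residue_classes (residue_class k r `&` residue_class l s).
  move=> _ _ [k [r ->]] [l [s ->]]; case: (leqP l k) => [|/ltnW]; first exact: H.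
  by rewrite setIC; exact: H.
move=> lk; have [rs|rs] := eqVneq (r %% p ^ l)%N s.
  exists k, r; apply: setIidl => x /= xr.
  by rewrite /residue_class/= (padic_res_modX _ lk) xr.
(* No residue mod p^k equals p^k, so this class is empty. *)
exists k, (p ^ k)%N; apply/seteqP; split=> [x [/= xr]|x /= xk].
  rewrite /residue_class/= (padic_res_modX _ lk) xr => /eqP.
  by rewrite (negPf rs).
by have := padic_res_lt x k; rewrite xk ltnn.
Qed.

Lemma open_residueP {U : set Zp} {x} : open U -> U x ->
  exists k, residue_class k (padic_res x k) `<=` U.
Proof.
rewrite openE => /[apply] /nbhs_ballP[/= e e0 xeU].
have p1 : (1 < p)%N by exact: prime_gt1.
have [k ke] : exists k, p%:R ^- k <= e.
  (* This k exceeds 1/e, and p^k > k. *)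
  exists (Num.bound e^-1).
  rewrite invf_ple ?posrE ?exprn_gt0 ?ltr0n ?(ltnW p1)//.
  rewrite (le_trans (ltW (archi_boundP _)))// ?invr_ge0 ?ltW//.
  by rewrite -natrX ltr_nat ltn_expl.
(* The open ball of radius p^-k is a class mod p^(k+1). *)
exists k.+1 => y /= yx; apply/xeU/(le_ball ke).
by apply/padic_ballP.
Qed.

Lemma measurable_residue_classesE : @measurable _ Zp = <<s residue_classes >>.
Proof.
rewrite padic_measurableE; apply/seteqP; split; apply: smallest_sub.
- exact: smallest_sigma_algebra.
- move=> U oU.
  (* An open set is the union of the classes it contains, and there are only countably many
     classes. *)
  have -> : U = \bigcup_k \bigcup_(r in [set r | residue_class k r `<=` U])
      residue_class k r.
    apply/seteqP; split=> [x Ux|x [k _ [r /= rU xr]]]; last exact: rU.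
    have [k kU] := open_residueP oU Ux.
    by exists k => //; exists (padic_res x k).
  apply: (@bigcupT_measurable _ (g_sigma_algebraType residue_classes)) => k.
  apply: (@bigcup_measurable _ (g_sigma_algebraType residue_classes)) => r _.
  by apply: sub_sigma_algebra; exists k, r.
- exact: smallest_sigma_algebra.
- by move=> _ [k [r ->]]; apply: sub_sigma_algebra; exact: open_residue_class.
Qed.

(** * Compatible maps and reduction mod p^k *)

Lemma compatible_continuous {f} : compatible f -> continuous f.
Proof.
move=> /compatibleP cf; apply/continuousP => U oU; rewrite openE => x /= Ufx.
have [k kU] := open_residueP oU Ufx.
apply: (filterS (P := residue_class k (padic_res x k))).
  by move=> y /= yx; apply: kU; exact: cf.
exact/open_nbhs_nbhs/(conj (open_residue_class _ _)).
Qed.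

Lemma compatible_measurable {f} : compatible f -> measurable_fun setT f.
Proof.
move=> /compatible_continuous/continuousP cf.
apply: measurability; first exact: padic_measurableE.
by move=> _ [U oU <-]; rewrite setTI; apply: sub_sigma_algebra; exact: cf.
Qed.

(** For compatible f, injectivity of the induced map on Z/p^k, stated without forming the
    quotient. *)
Definition injective_mod f k := forall x y,
  padic_res (f x) k = padic_res (f y) k -> padic_res x k = padic_res y k.

Lemma preimage_residue_class {f k} x : compatible f -> injective_mod f k ->
  f @^-1` residue_class k (padic_res (f x) k) = residue_class k (padic_res x k).
Proof.
move=> /compatibleP cf injf.
by apply/seteqP; split=> y /=; [exact: injf|exact: cf].
Qed.

(** Reducing f i mod p^k gives an injective self-map of the finite set ['I_(p ^ k)], hence a
    bijection. *)
Lemma residue_inj_surj {f k r} : injective_mod f k -> (r < p ^ k)%N ->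
  exists x, padic_res (f x) k = r.
Proof.
move=> injf rk.
pose g (i : 'I_(p ^ k)) : 'I_(p ^ k) := Ordinal (padic_res_lt (f i%:R) k).
have /injF_bij[h _ gh] : injective g.
  move=> i j [/injf]; rewrite !padic_res_natr !modn_small// => ij.
  exact: val_inj.
by exists (h (Ordinal rk))%:R; have := congr1 val (gh (Ordinal rk)).
Qed.

(** * Haar measure of residue classes *)

Section Haar.
Context {R : realType} {mu : probability Zp R}.
Hypothesis mu_haar : normalized_haar mu.
Local Open Scope ereal_scope.

Lemma haar_residue_class x k :
  mu (residue_class k (padic_res x k)) = mu (residue_class k 0).
Proof.
by rewrite residue_class_add mu_haar//; exact: measurable_residue_class.
Qed.

(** The p^k classes have equal measure and cover a space of measure 1. *)
Lemma haar_residue_class_gt0 k : 0 < mu (residue_class k 0).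
Proof.
rewrite lt0e measure_ge0 andbT; apply/eqP => mu0.
have : mu setT <= \sum_(r < p ^ k) mu (residue_class k r).
  apply: content_subadditive => //.
    by move=> r _; exact: measurable_residue_class.
  move=> x _; rewrite -bigcup_mkord; exists (padic_res x k) => //=.
  exact: padic_res_lt.
rewrite big1 => [|r _].
  by rewrite probability_setT leNgt lte01.
have -> : nat_of_ord r = padic_res (r%:R : Zp) k.
  by rewrite padic_res_natr modn_small.
by rewrite haar_residue_class.
Qed.

Lemma preserves_measureP {f} : compatible f ->
  preserves_measure mu f <-> forall k, injective_mod f k.
Proof.
move=> cf; have mf := compatible_measurable cf.
split=> [pf k x y fxy|injf S mS]; last first.
  (* Two finite measures agreeing on a generating pi-system are equal. The only class mod p^0 is the
     whole space, so a constant sequence serves as the cover. *)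
  apply: (measure_unique residue_classes (fun=> residue_class 0 0) _ _ _ _
      (pushforward mu f) mu _ _ _ mS) => //.
  - exact: measurable_residue_classesE.
  - exact: setI_closed_residue_classes.
  - by move=> _; exists 0%N, 0%N.
  - apply/seteqP; split=> // x _; exists 0%N => //=.
    by have := padic_res_lt x 0; rewrite expn0 ltnS leqn0 => /eqP.
  - move=> _ [k [r ->]].
    change (mu (f @^-1` residue_class k r) = mu (residue_class k r)).
    have [rk|kr] := ltnP r (p ^ k).
      have [x <-] := residue_inj_surj (injf k) rk.
      by rewrite (preimage_residue_class x cf (injf k)) !haar_residue_class.
    have -> : residue_class k r = set0.
      apply/seteqP; split=> // x /= xr.
      by move: kr; rewrite -xr leqNgt padic_res_lt.
    by rewrite preimage_set0.
  - move=> _; rewrite (le_lt_trans (probability_le1 _ _)) ?ltry//.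
    by rewrite -[X in measurable X]setTI; apply: mf => //;
      exact: measurable_residue_class.
(* Otherwise f sends two disjoint classes A and B into one class, whose preimage is then too
   large. *)
apply: contrapT => xy.
set A := residue_class k (padic_res x k).
set B := residue_class k (padic_res y k).
have mC r := measurable_residue_class k r.
have AB0 : A `&` B = set0.
  by apply/seteqP; split=> // z [/= zx zy]; apply: xy; rewrite -zx -zy.
have fC : A `|` B `<=` f @^-1` residue_class k (padic_res (f x) k).
  have /compatibleP cf' := cf.
  move=> z [] /= /cf'; first by [].
  by move=> zy; rewrite /residue_class/= zy fxy.
have : mu (A `|` B) <= mu (f @^-1` residue_class k (padic_res (f x) k)).
  apply: le_measure => //; apply: mem_set.
    exact: (measurableU _ _ (mC _) (mC _)).
  by rewrite -[X in measurable X]setTI; exact: mf.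
have -> : mu (A `|` B) = mu A + mu B by exact: (measureU _ (mC _) (mC _) AB0).
(* All three classes have the same measure c, so c + c <= c, although c is positive and finite. *)
rewrite (pf _ (mC _)) /A /B !haar_residue_class.
have := haar_residue_class_gt0 k.
have /fineK <- := fin_num_measure mu _ (mC 0%N).
by rewrite -EFinD lte_fin lee_fin gerDl leNgt => ->.
Qed.

End Haar.

(** * From residues to digits *)

Section Coordinates.
Context {f : Zp -> Zp} {phi : forall k, k.+1.-tuple 'I_p -> 'I_p}.
Hypothesis f_phi : coordinate_representation f phi.

(** Uniqueness of the expansion lets the identity of series be read digit by digit. *)
Lemma padic_digit_coordinate x k :
  padic_digit (f x) k = phi k [tuple padic_digit x i | i < k.+1].
Proof. by rewrite -[in LHS](padic_digitK x) f_phi padic_seriesK. Qed.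

Lemma coordinate_injectiveP : compatible f ->
  (forall k, injective_mod f k) <->
  forall k (t : k.-tuple 'I_p),
    injective (fun u : 'I_p => phi k [tuple of rcons t u]).
Proof.
move=> /compatibleP cf; split=> [injf k t u v tuv|injphi k x y].
  (* The default value of [nth] matters: the digits are those of t, then w at position k and ever
     after. *)
  pose a w i := nth w t i.
  have aE w : [tuple a w i | i < k.+1] = [tuple of rcons t w].
    rewrite mktuple_rcons; congr [tuple of rcons _ _].
      by apply: eq_from_tnth => i; rewrite tnth_mktuple (tnth_nth w).
    by rewrite /a nth_default// size_tuple.
  pose x w : Zp := padic_series p_pr (a w).
  have xE w : padic_digit (x w) = a w by exact: padic_seriesK.
  have xk : padic_res (x u) k = padic_res (x v) k.
    apply/padic_res_eqP => i ik; rewrite !xE.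
    by apply: set_nth_default; rewrite size_tuple.
  have : padic_res (x u) k.+1 = padic_res (x v) k.+1.
    (* The images agree mod p^k by compatibility, and in digit k by [tuv]. *)
    apply: injf; rewrite !padic_resS (cf _ _ _ xk) !padic_digit_coordinate.
    by do 2 (under eq_mktuple do rewrite xE; rewrite aE); rewrite tuv.
  move=> /padic_res_eqP/(_ _ (ltnSn k)).
  by rewrite !xE /a !nth_default ?size_tuple.
(* Digits are recovered one at a time: once the lower ones agree, x and y share the same injective
   map in digit k. *)
elim: k => [|k IHk] fxy; first by rewrite !padic_res_digits !big_ord0.
have xyk := IHk (padic_res_eq_le (leqnSn k) fxy).
suff xy : padic_digit x k = padic_digit y k by rewrite !padic_resS xyk xy.
pose t (z : Zp) : k.-tuple 'I_p := [tuple padic_digit z i | i < k].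
have txy : t x = t y.
  apply: eq_from_tnth => i; rewrite !tnth_mktuple.
  by move/padic_res_eqP: xyk => ->.
apply: (injphi k (t x)); rewrite [in RHS]txy -!mktuple_rcons.
by rewrite -!padic_digit_coordinate; move/padic_res_eqP: fxy; exact.
Qed.

End Coordinates.

End ResidueClasses.

Theorem theorem3p1 (R : realType) (p : nat) (p_pr : prime p)
    (mu : probability (padic_int p_pr) R) (mu_haar : normalized_haar mu)
    (f : padic_int p_pr -> padic_int p_pr) (f_compatible : compatible f)
    (phi : forall k : nat, k.+1.-tuple 'I_p -> 'I_p)
    (f_phi : coordinate_representation f phi) :
  preserves_measure mu f <->
  bijective (fun x0 : 'I_p => phi 0%N [tuple x0]) /\
  (forall k : nat, (0 < k)%N -> forall x : k.-tuple 'I_p,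
     bijective (fun xk : 'I_p => phi k [tuple of rcons x xk])).
Proof.
(* The only 0-tuple is empty, so the case k = 0 of the uniform condition is the condition on the
   first digit. *)
have phi0 (t : 0.-tuple 'I_p) :
    (fun u => phi 0%N [tuple of rcons t u]) = (fun u => phi 0%N [tuple u]).
  by apply/funext => u; congr (phi _ _); apply: val_inj; rewrite /= tuple0.
rewrite (preserves_measureP mu_haar f_compatible).
rewrite (coordinate_injectiveP f_phi f_compatible).
split=> [inj|[bij0 bij] [|k] t].
(* An injective self-map of the finite set ['I_p] is bijective. *)
- split=> [|k _ t]; apply: injF_bij; last exact: inj.
  by rewrite -(phi0 [tuple]); exact: inj.
- by rewrite phi0; exact: bij_inj.
- exact/bij_inj/bij.
Qed.
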